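(* Let $(C,\Omega)$ be a pure finite chain complex of order $d\geq1$ over a principal ring $R$, and let $\Omega_d$ be a basis of $C_d$ with $k_d\geq1$ elements. Let there be $n<k_d$ critical elements $g_1,\ldots,g_n$ in $\Omega_d$ and let all other basis elements be noncritical. Let $\Omega_d$ be ordered in such a way that the noncritical elements come first: $$\Omega_d=\{e_1,\ldots,e_m,g_1,\ldots,g_n\},\qquad m+n=k_d.$$ Then the following holds: 1. $H_d(C)\cong R^n$. 2. For $n\geq1$, there exist unique cycles $\rho_1,\ldots,\rho_n$ in $H_d(C)\cong\ker\partial_d$ so that $\rho_i(g_j)=\delta_{ij}$. 3. For $n\geq1$, $\{\rho_1,\ldots,\rho_n\}$ is a basis of $H_d(C)$.
   Context: A principal ring $R$ is an integral domain (commutative with $1$) all of whose ideals are principal. A chain complex $(C,\Omega)$ over $R$ consists of free $R$-modules $C_\nu$ ($\nu\geq 0$), each with a fixed finite (possibly empty) basis $\Omega_\nu=\{e^\nu_1,\ldots,e^\nu_{k_\nu}\}$, and $R$-linear maps $\partial_\nu\colon C_\nu\to C_{\nu-1}$ ($\nu\geq1$), $\partial_0\colon C_0\to 0$, with $\partial_\nu\circ\partial_{\nu+1}=0$; $\Omega=\bigcup_\nu\Omega_\nu$. The basis is fixed except for permutations of its elements. The complex is finite of order $d$ if $C_\nu=0$ for $\nu>d$ and $C_d\neq0$. $H_\nu(C)=\ker\partial_\nu/\operatorname{im}\partial_{\nu+1}$. For $x=\sum_i a_ie^\nu_i\in C_\nu$, $\operatorname{supp}(x)=\{e^\nu_i\mid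 a_i\neq0\}$, $\operatorname{bd}(x)=\operatorname{supp}(\partial_\nu x)$, and $x(e^\nu_i):=a_i$ denotes the coefficient of $e^\nu_i$ in $x$. $\delta_{ij}$ is $1$ if $i=j$ and $0$ otherwise. A finite complex of order $d$ is pure if every $e\in\Omega_\nu$, $0\leq\nu\leq d-1$, lies in $\operatorname{bd}(f)$ for some $f\in\Omega_{\nu+1}$. Let $\Gamma$ be the set of maximal basis elements, i.e. of those $e\in\Omega$ with $e\notin\operatorname{bd}(f)$ for all $f\in\Omega$ (in a pure complex of order $d$, $\Gamma=\Omega_d$). Let each $\Omega_\nu$ have an ordering in which the elements of $\Omega_\nu\setminus\Gamma$ come first. A basis element $e^\nu_j\in\Omega_\nu\cap\Gamma$ with $j\geq2$ is called: critical if there exist $a_i\in R$, $1\leq i\leq j-1$, so that $\partial_\nu(e^\nu_j)=\sum_{i=1}^{j-1}a_i\partial_\nu(e^\nu_i)$; precritical if there exist $a_i\in R$, $1\leq i\leq j$, $a_j\neq0$, so that $a_j\partial_\nu(e^\nu_j)=\sum_{i=1}^{j-1}a_i\partial_\nu(e^\nu_i)$; noncritical if it is neither critical nor precritical. (The definition is made only for $j\geq2$.)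
   Formalization: The definitions of critical, precritical and noncritical, made only for j≥2, are extended to the first basis element with empty sums: it is critical if its boundary is 0 and noncritical if its boundary is nonzero; left unconstrained, the claim fails when the first boundary is 0. *)

(* Defs.v *)
From HB Require Import structures.
From mathcomp Require Import all_boot all_algebra.
From mathcomp Require Import boolp.

Set Implicit Arguments.
Unset Strict Implicit.
Unset Printing Implicit Defensive.

Import GRing.Theory.
Local Open Scope ring_scope.
Local Open Scope quotient_scope.

Definition is_ideal (R : idomainType) (I : R -> Prop) : Prop :=
  [/\ I 0,
      forall x y, I x -> I y -> I (x + y)
    & forall a x, I x -> I (a * x)].

Definition principal_ring (R : idomainType) : Prop :=
  forall I : R -> Prop, is_ideal I ->
    exists a, forall x, I x <-> exists b, x = b * a.

Definition is_basis (R : idomainType) (V : lmodType R) (k : nat)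
    (e : 'I_k -> V) : Prop :=
  forall x : V, exists! a : {ffun 'I_k -> R}, x = \sum_(i < k) a i *: e i.

(** MathComp provides the quotient [Quotient.quot I] of an abelian group [V] by
    a subgroup [I], but not its module structure when [I] is a submodule. *)
Section ModuleQuotient.
Variables (R : pzRingType) (V : lmodType R) (I : submodClosed V).

Definition submod_pred : {pred V} := I.

HB.instance Definition _ := GRing.isZmodClosed.Build V submod_pred
  (GRing.submod_closedB (GRing.submodClosedP I)).

Definition modquot : Type := Quotient.quot submod_pred.

HB.instance Definition _ := GRing.Zmodule.on modquot.

Definition modquot_pi (x : V) : modquot := \pi_(Quotient.quot submod_pred) x.

Definition modquot_scale (a : R) (q : modquot) : modquot :=
  modquot_pi (a *: repr (q : Quotient.quot submod_pred)).

Lemma modquot_piP x y : (modquot_pi x = modquot_pi y) <-> (x - y \in I).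
Proof.
have E := Quotient.idealrBE submod_pred x y.
split=> [/eqP xy|xy]; first by have: x - y \in submod_pred by rewrite E.
by apply/eqP; move: xy; rewrite -[x - y \in I]/(x - y \in submod_pred) E.
Qed.

Lemma modquot_pi_surj q : exists x, modquot_pi x = q.
Proof. by exists (repr (q : Quotient.quot submod_pred)); rewrite /modquot_pi reprK. Qed.

Lemma modquot_piD : {morph modquot_pi : x y / x + y}.
Proof. by move=> x y; rewrite /modquot_pi raddfD. Qed.

Lemma modquot_piZ a x : modquot_pi (a *: x) = modquot_scale a (modquot_pi x).
Proof.
apply/modquot_piP; rewrite -scalerBr rpredZ //.
by apply/modquot_piP; rewrite /modquot_pi reprK.
Qed.

Lemma modquot_scaleA a b q :
  modquot_scale a (modquot_scale b q) = modquot_scale (a * b) q.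
Proof. by have [x <-] := modquot_pi_surj q; rewrite -!modquot_piZ scalerA. Qed.

Lemma modquot_scale1 : left_id 1 modquot_scale.
Proof.
by move=> q; have [x <-] := modquot_pi_surj q; rewrite -modquot_piZ scale1r.
Qed.

Lemma modquot_scaleDr : right_distributive modquot_scale +%R.
Proof.
move=> a p q; have [x <-] := modquot_pi_surj p.
have [y <-] := modquot_pi_surj q.
by rewrite -modquot_piD -!modquot_piZ -modquot_piD scalerDr.
Qed.

Lemma modquot_scaleDl q : {morph modquot_scale^~ q : a b / a + b}.
Proof.
move=> a b; have [x <-] := modquot_pi_surj q.
by rewrite -!modquot_piZ -modquot_piD scalerDl.
Qed.

HB.instance Definition _ := GRing.Zmodule_isLmodule.Build R modquot
  modquot_scaleA modquot_scale1 modquot_scaleDr modquot_scaleDl.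

Lemma modquot_pi_linear : linear modquot_pi.
Proof. by move=> a x y; rewrite modquot_piD modquot_piZ. Qed.

HB.instance Definition _ :=
  GRing.isLinear.Build R V modquot _ modquot_pi modquot_pi_linear.

End ModuleQuotient.

(** The codomain of the v-th boundary map: C_(v-1), and 0 for v = 0. *)
Definition target (R : idomainType) (M : nat -> lmodType R) (v : nat) :
    lmodType R :=
  if v is v'.+1 then M v' else 'rV[R]_0.

Record based_complex (R : idomainType) := BasedComplex {
  chain : nat -> lmodType R;
  brank : nat -> nat;
  belt : forall v, 'I_(brank v) -> chain v;
  belt_basis : forall v, is_basis (@belt v);
  diff : forall v, {linear chain v -> target chain v};
  diff_diff : forall v (x : chain v.+1), diff v (diff v.+1 x) = 0
}.

Arguments belt {R} b {v}.
Arguments diff {R} b {v}.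

Section Complex.
Variables (R : idomainType) (C : based_complex R).

(** The coordinates of [x]; [coef x i] is the coefficient x(e_i). *)
Definition coef v (x : chain C v) : {ffun 'I_(brank C v) -> R} :=
  sval (cid (belt_basis x)).

Definition supp v (x : chain C v) : {set 'I_(brank C v)} :=
  [set i | coef x i != 0].

(** Basis elements are identified with their indices. Degree-0 elements have
    empty bd, as their boundary lies in the zero module; they are left out. *)
Definition bd v (f : 'I_(brank C v.+1)) : {set 'I_(brank C v)} :=
  supp (diff C (belt C f) : chain C v).

Definition has_order (d : nat) : Prop :=
  (forall v, (d < v)%N -> forall x : chain C v, x = 0) /\
  (exists x : chain C d, x <> 0).

Definition pure (d : nat) : Prop :=
  has_order d /\
  forall v, (v < d)%N -> forall i : 'I_(brank C v),
    exists f : 'I_(brank C v.+1), i \in bd f.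

(** The set Gamma; only (v+1)-dimensional elements can have e_i in their bd. *)
Definition maximal v (i : 'I_(brank C v)) : Prop :=
  forall f : 'I_(brank C v.+1), i \notin bd f.

(** The ordering of each basis is that of its indices. For the first basis
    element the sums below are empty: it is critical iff its boundary is 0, and
    noncritical iff its boundary is nonzero. In a pure complex of order d the
    maximal elements are those of degree d, so they trivially come last. *)
Definition critical v (j : 'I_(brank C v)) : Prop :=
  maximal j /\
  exists a : 'I_(brank C v) -> R,
    diff C (belt C j) =
      \sum_(i < brank C v | (i < j)%N) a i *: diff C (belt C i).

Definition precritical v (j : 'I_(brank C v)) : Prop :=
  maximal j /\
  exists a : 'I_(brank C v) -> R, a j != 0 /\
    a j *: diff C (belt C j) =
      \sum_(i < brank C v | (i < j)%N) a i *: diff C (belt C i).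

Definition noncritical v (j : 'I_(brank C v)) : Prop :=
  [/\ maximal j, ~ critical j & ~ precritical j].

Section Homology.
Variable v : nat.

Definition is_cycle : {pred chain C v} := [pred x | diff C x == 0].

Lemma is_cycle_submod : submod_closed is_cycle.
Proof.
split=> [|a x y]; rewrite !inE ?linear0 // => /eqP dx /eqP dy.
by rewrite linearP dx dy scaler0 addr0.
Qed.

HB.instance Definition _ :=
  GRing.isSubmodClosed.Build R (chain C v) is_cycle is_cycle_submod.

Record cycles := Cycle { cycle_val :> chain C v; _ : cycle_val \in is_cycle }.

HB.instance Definition _ := [isSub for cycle_val].
HB.instance Definition _ := [Choice of cycles by <:].
HB.instance Definition _ := [SubChoice_isSubLmodule of cycles by <:].

Definition is_boundary : {pred cycles} :=
  [pred z : cycles |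
    `[< exists c : chain C v.+1, (z : chain C v) = diff C c >]].

Lemma is_boundary_submod : submod_closed is_boundary.
Proof.
split=> [|a x y]; rewrite !inE.
  by apply/asboolP; exists 0; rewrite linear0.
move=> /asboolP[c xc] /asboolP[c' yc]; apply/asboolP; exists (a *: c + c').
by rewrite linearP -[LHS]/(a *: cycle_val x + cycle_val y) xc yc.
Qed.

HB.instance Definition _ :=
  GRing.isSubmodClosed.Build R cycles is_boundary is_boundary_submod.

Definition homology : lmodType R := modquot is_boundary.

Definition homology_class : {linear cycles -> homology} :=
  @modquot_pi R cycles is_boundary.

End Homology.
End Complex.

Arguments homology_class {R C v}.

(* Main.v *)
Require Import Defs.
From HB Require Import structures.
From mathcomp Require Import all_boot all_algebra.
From mathcomp Require Import boolp.

Set Implicit Arguments.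
Unset Strict Implicit.
Unset Printing Implicit Defensive.

Import GRing.Theory.
Local Open Scope ring_scope.

(** Write b_j for the basis elements in degree d and D for the boundary map.
    Two facts about the family of the D b_j carry the theorem.

    - Each D b_j is a combination of the D b_i with b_i noncritical: criticality
      rewrites D b_j in terms of earlier boundaries, and one recurses
      ([boundary_span]).
    - The D b_i with b_i noncritical are linearly independent: in a relation
      between them, the last element with a nonzero coefficient would be
      precritical ([noncritical_chain_cycle0]).

    Hence a cycle is determined by its coefficients at the critical elements
    (independence), and these coefficients can be prescribed at will: if
    D b_j = D x with x supported on noncritical elements, then b_j - x is a
    cycle with coefficient 1 at b_j and 0 at the other critical elements.  So
    reading off the critical coefficients is an isomorphism from the cycles to
    R^n ([critical_coefs_bij]).  As C_(d+1) = 0, there are no nonzero boundaries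
    in degree d and the cycles are the homology.  The rho_i are the preimages
    of the unit vectors under this isomorphism, whence their existence,
    uniqueness and the fact that they form a basis. *)

(** * Linear bijections onto R^n and dual families *)

Lemma inj_surj_bijective (A B : Type) (f : A -> B) :
  injective f -> (forall y, exists x, f x = y) -> bijective f.
Proof.
move=> f_inj f_surj; pose h y := sval (cid (f_surj y)).
have hK : cancel h f by move=> y; rewrite /h; case: cid.
by exists h => // x; apply: f_inj; rewrite hK.
Qed.

Lemma linear_inverse (R : pzRingType) (U V : lmodType R) (f : {linear U -> V}) :
  bijective f -> exists2 h : {linear V -> U}, cancel f h & cancel h f.
Proof.
move=> [h fK hK].
pose hlin := GRing.isLinear.Build R V U _ h (can2_linear fK hK).
by exists (HB.pack_for {linear V -> U} h hlin).
Qed.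

Section DualFamily.
Variables (R : idomainType) (V : lmodType R) (n : nat).
Variable phi : {linear V -> 'rV[R]_n}.
Hypothesis phi_bij : bijective phi.

Lemma dual_family_exists_unique :
  exists! rho : {ffun 'I_n -> V}, forall i j, phi (rho i) 0 j = (i == j)%:R.
Proof.
have [h phiK hK] := phi_bij.
exists [ffun i => h (delta_mx 0 i)]; split=> [i j|rho rhoP].
  by rewrite ffunE hK mxE eqxx eq_sym.
apply/ffunP => i; rewrite ffunE; apply: (can_inj phiK); rewrite hK.
by apply/rowP => j; rewrite rhoP mxE eqxx eq_sym.
Qed.

(** The coordinates of [x] in the dual family are the entries of [phi x]. *)
Lemma dual_family_basis (rho : 'I_n -> V) :
  (forall i j, phi (rho i) 0 j = (i == j)%:R) -> is_basis rho.
Proof.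
move=> rhoP x.
have phi_sum (a : 'I_n -> R) j : phi (\sum_i a i *: rho i) 0 j = a j.
  rewrite linear_sum summxE (bigD1 j) //= linearZ mxE rhoP eqxx mulr1.
  by rewrite big1 ?addr0 // => i /negPf ij; rewrite linearZ mxE rhoP ij mulr0.
exists [ffun i => phi x 0 i]; split=> [|a ->].
  by apply: (bij_inj phi_bij); apply/rowP => j; rewrite phi_sum ffunE.
by apply/ffunP => j; rewrite ffunE phi_sum.
Qed.

End DualFamily.

(** * Coordinates in a based complex *)

Section Coordinates.
Variables (R : idomainType) (C : based_complex R) (v : nat).
Implicit Types x y : chain C v.

Lemma coef_sum_belt x : x = \sum_i coef x i *: belt C i.
Proof. by rewrite /coef; case: cid => a []. Qed.

Lemma coef_unique (a : {ffun 'I_(brank C v) -> R}) x :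
  x = \sum_i a i *: belt C i -> coef x = a.
Proof.
move=> xE; have [c [_ cU]] := belt_basis x.
by rewrite -(cU _ xE) (cU _ (coef_sum_belt x)).
Qed.

Lemma coefP a x y i : coef (a *: x + y) i = a * coef x i + coef y i.
Proof.
suff -> : coef (a *: x + y) = [ffun i => a * coef x i + coef y i].
  by rewrite ffunE.
apply: coef_unique; rewrite {1}(coef_sum_belt x) {1}(coef_sum_belt y).
rewrite scaler_sumr -big_split; apply: eq_bigr => j _.
by rewrite ffunE scalerDl scalerA.
Qed.

Lemma coef_belt i j : coef (belt C i : chain C v) j = (i == j)%:R.
Proof.
suff -> : coef (belt C i) = [ffun j => (i == j)%:R] by rewrite ffunE.
apply: coef_unique; rewrite (bigD1 i) //= ffunE eqxx scale1r.
rewrite big1 ?addr0 // => l /negPf il.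
by rewrite ffunE eq_sym il scale0r.
Qed.

Lemma coef_sub x y i : coef (x - y) i = coef x i - coef y i.
Proof. by rewrite -scaleN1r addrC coefP mulN1r addrC. Qed.

Lemma coef0 i : coef (0 : chain C v) i = 0.
Proof. by rewrite -(subrr 0) coef_sub subrr. Qed.

Lemma diff_coef x : diff C x = \sum_i coef x i *: diff C (belt C i).
Proof.
rewrite {1}(coef_sum_belt x) linear_sum.
by apply: eq_bigr => i _; rewrite linearZ.
Qed.

Lemma coef_inj x y : coef x =1 coef y -> x = y.
Proof.
move=> xy; rewrite (coef_sum_belt x) (coef_sum_belt y).
by apply: eq_bigr => i _; rewrite xy.
Qed.

End Coordinates.

(** * Boundaries of critical and noncritical elements *)

Section CriticalElements.
Variables (R : idomainType) (C : based_complex R) (v : nat).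
Variable P : pred 'I_(brank C v).

Definition supported (x : chain C v) := forall i, ~~ P i -> coef x i = 0.

(** The boundaries of chains supported on [P] form a submodule, so criticality
    together with the claim for earlier indices gives it for the next one. *)
Lemma boundary_span :
    (forall i, ~~ P i -> critical i) ->
  forall j, exists2 x, supported x & diff C (belt C j) = diff C x.
Proof.
move=> Pcrit j; have [k] := ubnP (nat_of_ord j); elim: k j => // k IHk j jk.
have [Pj|nPj] := boolP (P j).
  exists (belt C j) => // i nPi; rewrite coef_belt.
  by case: eqP nPi => // <-; rewrite Pj.
have [_ [a ->]] := Pcrit j nPj.
elim/big_ind: _ => [|y z [x xP ->] [x' xP' ->]|i ij].
- by exists 0 => [i _|]; rewrite ?coef0 ?linear0.
- exists (1 *: x + x') => [i nPi|]; last by rewrite scale1r linearD.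
  by rewrite coefP xP // xP' // mulr0 addr0.
- have [x xP ->] := IHk i (leq_trans ij jk).
  exists (a i *: x + 0) => [l nPl|]; last by rewrite addr0 linearZ.
  by rewrite coefP coef0 xP // mulr0 addr0.
Qed.

(** The last element in the support of a nonzero cycle satisfies the equation
    that defines precritical elements. *)
Lemma noncritical_chain_cycle0 x :
    (forall i, P i -> noncritical i) ->
  supported x -> diff C x = 0 -> x = 0.
Proof.
move=> Pnc xP dx0; have [supp0|[i0 xi0]] := set_0Vmem (supp x).
  apply: coef_inj => i; rewrite coef0; apply/eqP.
  by move/setP/(_ i): supp0; rewrite !inE => /negbFE.
have [j xj jmax] := @arg_maxnP _ i0 (mem (supp x)) (@nat_of_ord _) xi0.
rewrite /= inE in xj; have Pj : P j by apply: contraNT xj => /xP ->.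
have [jmaximal _ []] := Pnc j Pj; split=> //.
(* Isolating the j-th term of the relation negates the other coefficients. *)
exists (fun i => if i == j then coef x j else - coef x i).
rewrite eqxx; split=> //; apply/eqP; rewrite -subr_eq0 -sumrN; apply/eqP.
rewrite -[RHS]dx0 (diff_coef x) [RHS](bigD1 j) //=.
congr (_ + _).
rewrite big_mkcond [RHS]big_mkcond; apply: eq_bigr => i _.
case: ltngtP => [ij|ji|/val_inj ->]; last by rewrite eqxx.
  by rewrite -val_eqE /= ltn_eqF // scaleNr opprK.
rewrite -val_eqE /= gtn_eqF //.
have -> : coef x i = 0; last by rewrite scale0r.
apply: contraTeq ji => xi; rewrite -leqNgt.
by apply: (jmax i); rewrite /= inE.
Qed.

End CriticalElements.

(** * The critical coefficients of a cycle *)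

Section CriticalCoefficients.
Variables (R : idomainType) (C : based_complex R) (v n : nat).
Variable g : 'I_n -> 'I_(brank C v).

Definition critical_coefs (z : cycles C v) : 'rV[R]_n :=
  \row_j coef (z : chain C v) (g j).

Lemma critical_coefs_is_linear : linear critical_coefs.
Proof. by move=> a y z; apply/rowP => j; rewrite !mxE -coefP. Qed.

HB.instance Definition _ :=
  GRing.isLinear.Build R (cycles C v) 'rV[R]_n _ critical_coefs
    critical_coefs_is_linear.

(** Injectivity is the independence of the noncritical boundaries, applied to
    a cycle with no critical coefficients; surjectivity corrects each critical
    element to a cycle by a chain of noncritical elements. *)
Lemma critical_coefs_bij :
    injective g -> (forall j, critical (g j)) ->
    (forall i, i \notin codom g -> noncritical i) ->
  bijective critical_coefs.
Proof.
move=> g_inj g_crit g_nc; pose P := [pred i | i \notin codom g].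
have P_crit i : ~~ P i -> critical i by rewrite negbK => /codomP[j ->].
have gP j : ~~ P (g j) by rewrite negbK codom_f.
apply: inj_surj_bijective => [|w].
  apply: raddf_inj => z z0; apply: val_inj.
  apply: (noncritical_chain_cycle0 (P := P)) => // [i|].
    by rewrite negbK => /codomP[j ->]; move/rowP/(_ j): z0; rewrite !mxE.
  by case: z {z0} => z /= /eqP.
have cycle_of j : exists z : cycles C v, critical_coefs z = delta_mx 0 j.
  have [x xP dx] := boundary_span P_crit (g j).
  have zP : belt C (g j) - x \in @is_cycle R C v.
    by rewrite inE linearB /= dx subrr.
  exists (Cycle zP); apply/rowP => l.
  rewrite !mxE /= coef_sub coef_belt (xP _ (gP l)) subr0.
  by rewrite (inj_eq g_inj) eq_sym.
have [z zE] := choice cycle_of.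
exists (\sum_j w 0 j *: z j); rewrite linear_sum [RHS]row_sum_delta.
by apply: eq_bigr => j _; rewrite linearZ /= zE.
Qed.

End CriticalCoefficients.

(** With C_(v+1) = 0 the only boundary is 0, so the quotient is by 0. *)
Lemma homology_class_bij (R : idomainType) (C : based_complex R) (v : nat) :
    (forall x : chain C v.+1, x = 0) ->
  bijective (@homology_class R C v).
Proof.
move=> C0; apply: inj_surj_bijective => [x y|q].
  move=> /modquot_piP; rewrite inE => /asboolP[c].
  by rewrite (C0 c) linear0 => xy; apply/subr0_eq/val_inj.
exact: modquot_pi_surj.
Qed.

(** * Homology in the top degree *)

Theorem theorem3p13 (R : idomainType) (hR : principal_ring R)
    (C : based_complex R) (d : nat) (hd : (1 <= d)%N) (hpure : pure C d)
    (hk : (1 <= brank C d)%N)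
    (m n : nat) (hn : (n < brank C d)%N) (hmn : (m + n)%N = brank C d)
    (e : 'I_m -> 'I_(brank C d)) (g : 'I_n -> 'I_(brank C d))
    (heg : bijective (fun s : 'I_m + 'I_n =>
                        match s with inl i => e i | inr j => g j end))
    (hnoncrit : forall i, noncritical (e i))
    (hcrit : forall j, critical (g j)) :
  [/\ exists f : {linear homology C d -> 'rV[R]_n}, bijective f,
      (1 <= n)%N ->
        bijective (@homology_class R C d) /\
        (exists! rho : {ffun 'I_n -> cycles C d},
           forall i j, coef (rho i) (g j) = (i == j)%:R)
    & (1 <= n)%N ->
        forall rho : {ffun 'I_n -> cycles C d},
          (forall i j, coef (rho i) (g j) = (i == j)%:R) ->
          is_basis (fun i => homology_class (rho i))].
Proof.
have g_inj : injective g.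
  by move=> i j gij; have [] := bij_inj heg (x1 := inr i) (x2 := inr j) gij.
have g_nc i : i \notin codom g -> noncritical i.
  have [h _ /(_ i) <-] := heg; case: (h i) => [l _|l]; first exact: hnoncrit.
  by rewrite codom_f.
have phi_bij := critical_coefs_bij g_inj hcrit g_nc.
have [[C0 _] _] := hpure.
have cl_bij := homology_class_bij (C0 _ (ltnSn d)).
have [cl' clK clK'] := linear_inverse cl_bij.
pose f : {linear homology C d -> 'rV[R]_n} := critical_coefs g \o cl'.
have f_bij : bijective f by apply: bij_comp => //; exists homology_class.
split=> [|_|_ rho rhoP]; first by exists f.
  split=> //; have [rho [rhoP rhoU]] := dual_family_exists_unique phi_bij.
  exists rho; split=> [i j|rho' rhoP']; first by rewrite -rhoP mxE.
  by apply: rhoU => i j; rewrite mxE.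
apply: (dual_family_basis f_bij) => i j.
by rewrite /f /= clK mxE.
Qed.
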